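(* If $g\colon\mathbb{R}\to\mathbb{R}$ is a constant function, then $g$ is a composition of two Hamel functions, i.e. there exist Hamel functions $f,h\colon\mathbb{R}\to\mathbb{R}$ such that $g=h\circ f$.
   Context: A function $f\colon\mathbb{R}\to\mathbb{R}$ is a Hamel function if its graph $\{\langle x,f(x)\rangle : x\in\mathbb{R}\}\subset\mathbb{R}^2$ is a basis of $\mathbb{R}^2$ as a linear space over $\mathbb{Q}$. *)

(* Defs.v *)
From HB Require Import structures.
From mathcomp Require Import all_boot all_order all_algebra.
From mathcomp Require Import boolp classical_sets reals.

Set Implicit Arguments.
Unset Strict Implicit.
Unset Printing Implicit Defensive.

Import Order.TTheory GRing.Theory Num.Theory.

Local Open Scope classical_set_scope.
Local Open Scope ring_scope.

(* An R-module V, with R of characteristic 0, is viewed as a vector space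
   over the rationals by letting q : rat act as scaling by ratr q : R. *)
Section QBasis.
Context {R : realType} {V : lmodType R}.

Definition Qcomb (s : seq V) (c : V -> rat) : V :=
  \sum_(v <- s) ratr (c v) *: v.

(* A finite subset of B is a duplicate-free sequence of elements of B. *)
Definition Qfree (B : set V) : Prop :=
  forall (s : seq V) (c : V -> rat), uniq s -> {in s, forall v, B v} ->
    Qcomb s c = 0 -> {in s, forall v, c v = 0}.

Definition Qspan (B : set V) : set V :=
  [set u | exists (s : seq V) (c : V -> rat),
     [/\ uniq s, {in s, forall v, B v} & u = Qcomb s c]].

Definition Qbasis (B : set V) : Prop := Qfree B /\ Qspan B = [set: V].

End QBasis.

(* R^o is R as a module over itself, which makes R^o * R^o an R-module. *)
Definition graph {R : realType} (f : R -> R) : set (R^o * R^o) :=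
  [set ((x, f x) : R^o * R^o) | x in [set: R]].

Definition Hamel {R : realType} (f : R -> R) : Prop := Qbasis (graph f).

(* Main.v *)
(** Fix a Q-basis B of R. If L is Q-linear, then any u that equals L on B and
    L + phi off B, where phi maps the complement of B bijectively onto a basis,
    is a Hamel function: the kernel of Q^(R) -> R has a basis indexed by the
    complement of B, and u - L has to send it to a basis of R.
    Since R and B are equipotent, there is a bijection psi from the complement
    of B onto B. Let f be psi off B and the constant psi 0 on B, so that
    phi x = psi x - eps x * psi 0 with eps the sum of the coordinates; these
    values form a basis because eps 0 = 0. Let h be c on B and eps x * c + psi x
    off B. The range of f lies in B, where h is c.
    For the equipotence, B is chosen to contain an independent family indexed by
    R: sums of 1 / N! over pairwise almost disjoint infinite sets of N. *)
Require Import Defs.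
From HB Require Import structures.
From mathcomp Require Import all_boot all_order all_algebra.
From mathcomp Require Import boolp classical_sets functions cardinality reals.

Set Implicit Arguments.
Unset Strict Implicit.
Unset Printing Implicit Defensive.

Import Order.TTheory GRing.Theory Num.Theory.

Local Open Scope classical_set_scope.
Local Open Scope ring_scope.

(** * Linear algebra over the rationals inside real modules *)

Section QLinearAlgebra.
Context {R : realType}.
Implicit Types V W : lmodType R.

Definition Qsubspace V (S : set V) : Prop :=
  S 0 /\ forall (q : rat) x y, S x -> S y -> S (ratr q *: x + y).

Definition Qlinear V W (l : V -> W) : Prop :=
  forall (q : rat) x y, l (ratr q *: x + y) = ratr q *: l x + l y.

(** Indexed, unlike [Qfree]: equal values at two indices of [D] already give a relation, so a free
    family is injective on [D]. *)
Definition Qfree_family (I : eqType) V (D : set I) (e : I -> V) : Prop :=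
  forall (s : seq I) (c : I -> rat), uniq s -> {in s, forall i, D i} ->
    \sum_(i <- s) ratr (c i) *: e i = 0 -> {in s, forall i, c i = 0}.

Lemma Qlinear0 V W (l : V -> W) : Qlinear l -> l 0 = 0.
Proof.
move=> /(_ (-1) 0 0); rewrite scaler0 addr0 rmorphN1 scaleN1r => ->.
by rewrite addNr.
Qed.

Lemma Qlinear_sum V W (l : V -> W) (I : Type) (s : seq I) (c : I -> rat)
    (e : I -> V) : Qlinear l ->
  l (\sum_(i <- s) ratr (c i) *: e i) = \sum_(i <- s) ratr (c i) *: l (e i).
Proof.
move=> lin; elim: s => [|i s IH]; first by rewrite !big_nil Qlinear0.
by rewrite !big_cons lin IH.
Qed.

Lemma Qsubspace_sum V (S : set V) (I : eqType) (s : seq I) (c : I -> rat)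
    (e : I -> V) : Qsubspace S -> {in s, forall i, S (e i)} ->
  S (\sum_(i <- s) ratr (c i) *: e i).
Proof.
move=> [S0 SD]; elim: s => [|i s IH] Ss; first by rewrite big_nil.
rewrite big_cons; apply: SD; first by apply: Ss; rewrite mem_head.
by apply: IH => j js; apply: Ss; rewrite in_cons js orbT.
Qed.

Lemma Qspan_min V (B S : set V) : Qsubspace S -> B `<=` S -> Qspan B `<=` S.
Proof.
move=> subS BS _ [s [c [_ sB ->]]]; rewrite /Qcomb.
by have := @Qsubspace_sum _ S _ s c id subS; apply => v /sB /BS.
Qed.

(** The collected coefficients do not depend on [d], so a relation among the [e i] and its image
    under [d] are regrouped alike. *)
Lemma sum_regroup V W (I : eqType) (s : seq I) (c : I -> rat) (e : I -> V)
    (d : V -> W) :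
  \sum_(i <- s) ratr (c i) *: d (e i) =
  \sum_(w <- undup (map e s)) ratr (\sum_(i <- s | e i == w) c i) *: d w.
Proof.
under [RHS]eq_bigr => w _ do rewrite rmorph_sum scaler_suml big_mkcond.
rewrite exchange_big /= !big_seq; apply: eq_bigr => i si.
rewrite (bigD1_seq (e i)) ?undup_uniq ?mem_undup ?map_f//= eqxx.
rewrite big1 ?addr0// => w.
by rewrite eq_sym => /negPf ->.
Qed.

Lemma Qspan_sum V (B : set V) (I : eqType) (s : seq I) (c : I -> rat)
    (e : I -> V) : {in s, forall i, B (e i)} ->
  Qspan B (\sum_(i <- s) ratr (c i) *: e i).
Proof.
move=> sB; exists (undup (map e s)), (fun w => \sum_(i <- s | e i == w) c i).
split; first exact: undup_uniq; last exact: (sum_regroup s c e id).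
by move=> w; rewrite mem_undup => /mapP[i /sB + ->].
Qed.

Lemma Qsubspace_Qspan V (B : set V) : Qsubspace (Qspan B).
Proof.
split; first by exists [::], (fun=> 0); split => //; rewrite /Qcomb big_nil.
move=> q _ _ [s [c [_ sB ->]]] [t [d [_ tB ->]]].
rewrite /Qcomb scaler_sumr.
under eq_bigr => v _ do rewrite scalerA -rmorphM.
pose l := [seq (q * c v, v) | v <- s] ++ [seq (d v, v) | v <- t].
rewrite [X in Qspan B X](_ : _ = \sum_(p <- l) ratr p.1 *: p.2).
  apply: Qspan_sum => p; rewrite mem_cat => /orP[] /mapP[v + ->] /=.
    exact: sB.
  exact: tB.
by rewrite big_cat /= !big_map.
Qed.

Lemma sub_Qspan V (B : set V) : B `<=` Qspan B.
Proof.
move=> b Bb; exists [:: b], (fun=> 1); split => //.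
  by move=> v; rewrite inE => /eqP ->.
by rewrite /Qcomb big_seq1 rmorph1 scale1r.
Qed.

(** Vectors may repeat in [s]; once they are merged, freeness makes every coefficient vanish,
    whatever values [d] replace the vectors. *)
Lemma Qfree_sum0 V W (B : set V) (d : V -> W) (s : seq (rat * V)) :
  Qfree B -> {in s, forall p, B p.2} ->
  \sum_(p <- s) ratr p.1 *: p.2 = 0 -> \sum_(p <- s) ratr p.1 *: d p.2 = 0.
Proof.
move=> frB sB; rewrite (sum_regroup s fst snd id) => s0.
rewrite (sum_regroup s fst snd d) big_seq big1// => w ws.
rewrite (frB _ _ _ _ s0 w ws) ?undup_uniq ?rmorph0 ?scale0r//.
by move=> v; rewrite mem_undup => /mapP[p /sB + ->].
Qed.

Lemma Qfree_sum_eq V W (B : set V) (d : V -> W) (s t : seq (rat * V)) :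
  Qfree B -> {in s, forall p, B p.2} -> {in t, forall p, B p.2} ->
  \sum_(p <- s) ratr p.1 *: p.2 = \sum_(p <- t) ratr p.1 *: p.2 ->
  \sum_(p <- s) ratr p.1 *: d p.2 = \sum_(p <- t) ratr p.1 *: d p.2.
Proof.
move=> frB sB tB st; apply/subr0_eq; move/eqP: st; rewrite -subr_eq0 => /eqP.
pose t' := [seq (- p.1, p.2) | p <- t].
have sumB (U : lmodType R) (g : V -> U) :
    \sum_(p <- s) ratr p.1 *: g p.2 - \sum_(p <- t) ratr p.1 *: g p.2 =
    \sum_(p <- s ++ t') ratr p.1 *: g p.2.
  rewrite big_cat big_map /= -sumrN; congr (_ + _).
  by apply: eq_bigr => p _; rewrite rmorphN scaleNr.
rewrite (sumB _ id) sumB; apply: Qfree_sum0 frB _ => p.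
by rewrite mem_cat => /orP[/sB//|/mapP[r /tB + ->]].
Qed.

Lemma Qlinear_extension V W (B : set V) (d : V -> W) : Qbasis B ->
  exists l : V -> W, Qlinear l /\ forall b, B b -> l b = d b.
Proof.
move=> [frB spB].
have rep x : exists s : seq (rat * V),
    {in s, forall p, B p.2} /\ \sum_(p <- s) ratr p.1 *: p.2 = x.
  have [s [c [_ sB xE]]] : Qspan B x by rewrite spB.
  exists [seq (c v, v) | v <- s]; split; last by rewrite big_map.
  by move=> p /mapP[v + ->]; exact: sB.
(* [L x] is an arbitrary expansion of [x] over [B]; by [Qfree_sum_eq] the choice does not affect the
   extension. *)
have [L LP] := choice rep.
exists (fun x => \sum_(p <- L x) ratr p.1 *: d p.2); split=> [q x y|b Bb].
- pose t := [seq (q * p.1, p.2) | p <- L x] ++ L y.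
  have sumt (U : lmodType R) (g : V -> U) : \sum_(p <- t) ratr p.1 *: g p.2 =
      ratr q *: \sum_(p <- L x) ratr p.1 *: g p.2 +
      \sum_(p <- L y) ratr p.1 *: g p.2.
    rewrite big_cat big_map /= scaler_sumr; congr (_ + _).
    by apply: eq_bigr => p _; rewrite rmorphM scalerA.
  rewrite -sumt; apply: (Qfree_sum_eq _ frB (LP _).1) => [p|].
    rewrite mem_cat => /orP[/mapP[r + ->]|]; exact: (LP _).1.
  by rewrite (sumt _ id) !(LP _).2.
- rewrite (@Qfree_sum_eq _ _ B d _ [:: (1, b)] frB (LP _).1).
  + by rewrite big_seq1 rmorph1 scale1r.
  + by move=> p; rewrite inE => /eqP ->.
  + by rewrite (LP _).2 big_seq1 rmorph1 scale1r.
Qed.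

Lemma Qfree_inj V (B : set V) (I : eqType) (D : set I) (e : I -> V) :
  Qfree B -> set_inj D e -> (forall i, D i -> B (e i)) -> Qfree_family D e.
Proof.
move=> frB inj_e eB s c us sD s0 i si.
have us' : uniq (map e s).
  by rewrite map_inj_in_uniq// => x y /sD/mem_set Dx /sD/mem_set; exact: inj_e.
have s0' := sum_regroup s c e id; rewrite s0 undup_id// in s0'.
rewrite -(frB _ _ us' _ (esym s0') (e i)) ?map_f//; last first.
  by move=> w /mapP[j js ->]; exact/eB/sD.
rewrite big_mkcond (bigD1_seq i)//= eqxx big1_seq ?addr0// => j.
case/andP=> ji js; case: eqP => // /inj_e ejij.
by move: ji; rewrite ejij ?eqxx// inE; exact: sD.
Qed.

(** In terms of [e], a relation changes only in its coefficient at [i0], by [K]. So the other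
    coefficients vanish; they alone contribute to [K] since [k i0 = 0], hence the last one vanishes
    too. *)
Lemma Qfree_family_shift V (I : eqType) (D : set I) (e : I -> V) (i0 : I)
    (k : I -> rat) : Qfree_family D e -> D i0 -> k i0 = 0 ->
  Qfree_family D (fun i => e i - ratr (k i) *: e i0).
Proof.
move=> fre Di0 ki0.
have free_with s c : i0 \in s -> uniq s -> {in s, forall i, D i} ->
    \sum_(i <- s) ratr (c i) *: (e i - ratr (k i) *: e i0) = 0 ->
    {in s, forall i, c i = 0}.
  move=> i0s us sD s0.
  pose K := \sum_(i <- s) c i * k i.
  pose d i := c i - (if i == i0 then K else 0).
  have d0 : {in s, forall i, d i = 0}.
    apply: (fre s d us sD); rewrite -[RHS]s0.
    under [RHS]eq_bigr => i _ do rewrite scalerBr scalerA -rmorphM.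
    under [LHS]eq_bigr => i _ do rewrite /d rmorphB scalerBl.
    rewrite !sumrB -scaler_suml -rmorph_sum; congr (_ - _).
    rewrite (bigD1_seq i0)//= eqxx big1 ?addr0// => i /negPf ->.
    by rewrite rmorph0 scale0r.
  have c0 i : i \in s -> i != i0 -> c i = 0.
    by move=> /d0 + /negPf ii0; rewrite /d ii0 subr0.
  have K0 : K = 0.
    rewrite /K big_seq big1// => i si.
    by have [->|/(c0 _ si) ->] := eqVneq i i0; rewrite ?ki0 ?mulr0 ?mul0r.
  by move=> i /d0; rewrite /d K0; case: ifP; rewrite subr0.
(* A relation omitting [i0] is extended by [i0] with coefficient 0. *)
move=> s c us sD s0; have [i0s|i0s] := boolP (i0 \in s); first exact: free_with s0.
have neq i : i \in s -> (i == i0) = false.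
  by move=> si; apply: contraNF i0s => /eqP <-.
move=> i si; rewrite -(free_with (i0 :: s) (fun i => if i == i0 then 0 else c i) _ _ _ _ i).
- by rewrite neq.
- exact: mem_head.
- by rewrite /= i0s.
- by move=> j; rewrite inE => /predU1P[->//|/sD].
- rewrite big_cons eqxx rmorph0 scale0r add0r -[RHS]s0.
  by apply: eq_big_seq => j /neq ->.
- by rewrite inE si orbT.
Qed.

Lemma Qbasis_extension V (A : set V) : Qfree A -> exists B, A `<=` B /\ Qbasis B.
Proof.
move=> frA.
(* Zorn ranges over the sets added to [A], so that the empty chain is harmless: its union leaves [A]
   itself. *)
have [F FF totF|B [frB maxB]] := @Zorn_bigcup V (fun X => Qfree (A `|` X)).
  (* Freeness is finitary: each finite sequence lies in [A] together with one member of the chain,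
     or in [A] alone. *)
  have finF (s : seq V) : {in s, forall v, (A `|` \bigcup_(X in F) X) v} ->
      exists X, Qfree (A `|` X) /\ {in s, forall v, (A `|` X) v}.
    suff H : {in s, forall v, (A `|` \bigcup_(X in F) X) v} ->
      {in s, forall v, A v} \/ exists2 X, F X & {in s, forall v, (A `|` X) v}.
      move=> /H[sA|[X FX sX]]; last by exists X; split => //; exact: FF.
      by exists set0; rewrite setU0; split.
    elim: s => [|v s IH] sF; first by left.
    have {IH} := IH (fun w ws => sF w (mem_behead (s := v :: s) ws)).
    have consP (X : set V) : X v -> {in s, forall w, X w} ->
        {in v :: s, forall w, X w}.
      by move=> Xv Xs w; rewrite inE => /predU1P[->|/Xs].
    case: (sF _ (mem_head _ _)) => [Av|[Y FY Yv]] [sA|[X FX sX]].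
    + by left; exact: consP.
    + by right; exists X => //; apply: consP => //; left.
    + right; exists Y => //; apply: consP; first by right.
      by move=> w /sA; left.
    + right; case: (totF _ _ FX FY) => [XY|YX].
        exists Y => //; apply: consP; first by right.
        by move=> w /sX[|/XY]; [left|right].
      by exists X => //; apply: consP => //; right; exact: YX.
  by move=> s c us /finF[X [frX sX]]; exact: frX.
exists (A `|` B); split; first exact: subsetUl.
split => //; apply/seteqP; split => // v _; apply: contrapT => Nv.
have NBv : ~ (A `|` B) v by move=> /sub_Qspan.
apply: (maxB (v |` B)) => [|s c us sB s0].
  split; first exact: subsetUr.
  by move=> vB; apply: NBv; right; apply: vB; left.
have rest (t : seq V) : {in t, forall w, (A `|` (v |` B)) w} -> v \notin t ->
    {in t, forall w, (A `|` B) w}.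
  move=> tB vt w wt; case: (tB _ wt) => [|[wv|]]; [by left| |by right].
  by rewrite -wv wt in vt.
have [vs|vs] := boolP (v \in s); last exact: (frB _ _ us (rest s sB vs) s0).
have r := perm_to_rem vs.
have ut : uniq (rem v s) by exact: rem_uniq.
have vt : v \notin rem v s by rewrite mem_rem_uniqF.
have {}rest := rest (rem v s) (fun w wt => sB w (mem_rem wt)) vt.
move: s0; rewrite /Qcomb (perm_big _ r) big_cons /=.
have [cv|cv] := eqVneq (c v) 0.
  rewrite cv rmorph0 scale0r add0r => s0 w.
  by rewrite (perm_mem r) inE => /predU1P[->//|]; exact: (frB _ _ ut rest s0 w).
(* With [c v] nonzero the relation can be solved for [v], which puts [v] in the span of [A] and
   [B]. *)
move=> s0; case: Nv.
have [_ SD] := Qsubspace_Qspan (A `|` B).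
rewrite [v](_ : _ = ratr (- (c v)^-1) *: Qcomb (rem v s) c + 0); last first.
  have {s0} := congr1 (fun x => ratr (c v)^-1 *: x) s0.
  rewrite scalerDr scalerA -rmorphM mulVf// rmorph1 scale1r scaler0 addr0.
  by move/eqP; rewrite rmorphN scaleNr addr_eq0 => /eqP.
apply: SD; last exact: (Qsubspace_Qspan _).1.
by exists (rem v s), c.
Qed.

End QLinearAlgebra.

(** * Perturbing a Q-linear map into a Hamel function *)

Lemma Hamel_perturb (R : realType) (B : set R^o) (L phi u : R^o -> R^o) :
  Qbasis B -> Qlinear L -> (forall b, B b -> u b = L b) ->
  (forall x, ~ B x -> u x = L x + phi x) ->
  Qfree_family (~` B) phi -> Qspan (phi @` (~` B)) = [set: R^o] -> Hamel u.
Proof.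
move=> [frB spB] linL uB uN frphi spphi; split.
- move=> s c us sG s0.
  have vE v : v \in s -> v = (v.1, u v.1) by move=> /sG[x _ <-].
  have s1 : \sum_(v <- s) ratr (c v) *: v.1 = 0.
    by rewrite -(Qlinear_sum s c id (l := fst)) // -[LHS]/(Qcomb s c).1 s0.
  have s2 : \sum_(v <- s) ratr (c v) *: u v.1 = 0.
    have : \sum_(v <- s) ratr (c v) *: v.2 = 0.
      by rewrite -(Qlinear_sum s c id (l := snd)) // -[LHS]/(Qcomb s c).2 s0.
    by move=> s2; rewrite -[RHS]s2; apply: eq_big_seq => v /vE E; rewrite [X in _ = _ *: X.2]E.
  have inj1 : {in s &, injective fst}.
    by move=> v w /vE Ev /vE Ew vw; rewrite Ev vw -Ew.
  pose d x := c (x, u x).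
  have dE v : v \in s -> d v.1 = c v by move=> vs; rewrite /d -vE.
  pose sN := [seq v <- s | v.1 \notin B]; pose sB := [seq v <- s | v.1 \in B].
  (* Subtracting the image under [L] of the relation [s1] from [s2] cancels the terms over [B] and
     leaves a relation among values of [phi]. *)
  have cN : {in s, forall v, v.1 \notin B -> c v = 0}.
    move=> v vs vB; rewrite -dE//.
    apply: (frphi (map fst sN)).
    + rewrite map_inj_in_uniq ?filter_uniq// => x y.
      by rewrite !mem_filter => /andP[_ xs] /andP[_ ys]; exact: inj1.
    + by move=> x /mapP[w]; rewrite mem_filter => /andP[+ _] -> => /negP wB /mem_set.
    + rewrite big_map big_filter.
      have : L (\sum_(v <- s) ratr (c v) *: v.1) = 0 by rewrite s1 Qlinear0.
      rewrite Qlinear_sum// -[RHS]s2 => /esym/eqP; rewrite -subr_eq0 => /eqP.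
      rewrite -sumrB => sL; rewrite -[RHS]sL big_mkcond.
      apply: eq_big_seq => w ws; rewrite -scalerBr dE//.
      case: ifPn => [/negP|/negPn] wB; last first.
        by rewrite uB ?subrr ?scaler0//; exact/set_mem.
      by rewrite uN ?[L _ + _]addrC ?addrK// => /mem_set.
    + by rewrite map_f// mem_filter vB.
  move=> v vs; have [vB|] := boolP (v.1 \in B); last exact: cN.
  rewrite -dE//; apply: (frB (map fst sB)).
  + rewrite map_inj_in_uniq ?filter_uniq// => x y.
    by rewrite !mem_filter => /andP[_ xs] /andP[_ ys]; exact: inj1.
  + by move=> x /mapP[w]; rewrite mem_filter => /andP[+ _] -> => /set_mem.
  + rewrite /Qcomb big_map big_filter -[RHS]s1 big_mkcond.
    apply: eq_big_seq => w ws; rewrite dE//; case: ifPn => // wB.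
    by rewrite cN// rmorph0 scale0r.
  + by rewrite map_f// mem_filter vB.
- set G := graph u; have subG := Qsubspace_Qspan G; have [G0 GD] := subG.
  have inG x : Qspan G (x, u x) by apply: sub_Qspan; exists x.
  have add (x y : R^o * R^o) : Qspan G x -> Qspan G y -> Qspan G (x + y).
    by move=> Gx Gy; rewrite -[x]scale1r -(rmorph1 ratr); exact: GD.
  (* Over [B] the graphs of [L] and [u] agree; linearity of [L] carries membership in the span to
     every [x]. *)
  have graphL x : Qspan G (x, L x).
    have : Qspan B x by rewrite spB.
    apply: (Qspan_min (S := [set x | Qspan G (x, L x)])); last first.
      move=> b Bb /=; rewrite -uB//; exact: inG.
    split=> [|q y z] /=; first by rewrite (Qlinear0 linL); exact: G0.
    by rewrite linL; exact: GD.
  (* Off [B], [(0, phi x)] is the difference of the points of [u] and [L] over [x], so the whole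
     vertical axis is reached. *)
  have vert y : Qspan G (0, y).
    have : Qspan (phi @` (~` B)) y by rewrite spphi.
    apply: (Qspan_min (S := [set y | Qspan G (0, y)])).
      split=> //= q x z Gx Gz.
      rewrite (_ : (0, _) = ratr q *: (0, x) + (0, z)); first exact: GD.
      by congr pair; rewrite /= scaler0 addr0.
    move=> _ [x Bx <-] /=.
    rewrite (_ : (0, phi x) = ratr (- 1) *: (x, L x) + (x, u x)).
      exact: GD.
    by rewrite rmorphN1 uN// scaleN1r addrC; congr pair; rewrite /= ?subrr// addrAC subrr add0r.
  apply/seteqP; split => // -[x y] _.
  rewrite (_ : (x, y) = (x, L x) + (0, y - L x)); first exact: add.
  by congr pair; rewrite /= ?addr0// addrC subrK.
Qed.

(** * Rationally independent reals indexed by the reals *)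

Section FactorialSums.
Context {R : realType}.
Implicit Types (S : pred nat) (N : nat).

Definition psum_invfact S N : R := \sum_(n < N | S n) (n`!%:R)^-1.

(** The sum of the series, as the supremum of its nondecreasing and bounded partial sums. *)
Definition sum_invfact S : R := sup (range (psum_invfact S)).

Lemma psum_invfactS S N :
  psum_invfact S N.+1 = psum_invfact S N + (if S N then (N`!%:R)^-1 else 0).
Proof. by rewrite /psum_invfact big_mkcond big_ord_recr /= [in RHS]big_mkcond. Qed.

Lemma psum_invfact_le S N k : psum_invfact S N <= psum_invfact S (N + k).
Proof.
elim: k => [|k IH]; first by rewrite addn0.
by rewrite addnS psum_invfactS (le_trans IH)// lerDl; case: ifP; rewrite ?invr_ge0.
Qed.

(** One step from [m] to [m + 1] needs [1/m! + 2/(m+1)! <= 2/m!], that is [2 <= m + 1]; hence the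
    condition [0 < N]. *)
Lemma psum_invfact_tail S N k : (0 < N)%N ->
  psum_invfact S (N + k) + 2 / (N + k)`!%:R <= psum_invfact S N + 2 / N`!%:R.
Proof.
move=> N0; elim: k => [|k IH]; first by rewrite addn0.
apply: le_trans IH; rewrite addnS psum_invfactS -addrA lerD2l.
set m := (N + k)%N; have m0 : (0 < m)%N by rewrite addn_gt0 N0.
have fm : 0 < (m`!%:R : R) by rewrite ltr0n fact_gt0.
apply: (@le_trans _ _ ((m`!%:R)^-1 + 2 / (m.+1)`!%:R)).
  by rewrite lerD2r; case: ifP; rewrite // invr_ge0 ltW.
rewrite [leRHS]mulr_natl [leRHS]mulr2n lerD2l factS natrM invfM mulrA.
by rewrite ler_piMl ?invr_ge0 ?(ltW fm)// ler_pdivrMr ?ltr0n// mul1r ler_nat.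
Qed.

Lemma sum_invfact_bounds S N : (0 < N)%N ->
  0 <= sum_invfact S - psum_invfact S N <= 2 / N`!%:R.
Proof.
move=> N0.
have ub : ubound (range (psum_invfact S)) (psum_invfact S N + 2 / N`!%:R).
  move=> _ [M _ <-]; apply: le_trans (psum_invfact_le S M N) _.
  rewrite addnC; apply: le_trans (psum_invfact_tail S M N0).
  by rewrite lerDl divr_ge0.
apply/andP; split.
  by rewrite subr_ge0; apply: ub_le_sup; [exists (psum_invfact S N + 2 / N`!%:R)|exists N].
by rewrite lerBlDl; apply: ge_sup ub; exists (psum_invfact S 0), 0%N.
Qed.

Lemma fact_psum_invfact_int S N : N`!%:R * psum_invfact S N.+1 \is a Num.int.
Proof.
rewrite mulr_sumr rpred_sum// => n _.
have /dvdnP[q ->] : (n`! %| N`!)%N.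
  case: n => n /=; rewrite ltnS => /subnK <-.
  by elim: (N - n)%N => [|k IH] //; rewrite addSn factS dvdn_mull.
by rewrite natrM mulfK ?natr_int// pnatr_eq0 -lt0n fact_gt0.
Qed.

(* N! times the tail of the relation beyond N is an integer, smaller than 1 for
   large N, so all far tails vanish, and so do their differences. *)
Lemma sum_invfact_relation (I : eqType) (s : seq I) (a : I -> R)
    (S : I -> pred nat) : (forall i, i \in s -> a i \is a Num.int) ->
  \sum_(i <- s) a i * sum_invfact (S i) = 0 ->
  exists N0, forall N, (N0 <= N)%N -> \sum_(i <- s | S i N) a i = 0.
Proof.
move=> aZ s0.
pose T N := \sum_(i <- s) a i * (sum_invfact (S i) - psum_invfact (S i) N).
have TE N : T N = - \sum_(i <- s) a i * psum_invfact (S i) N.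
  rewrite -[RHS]add0r -[X in X - _]s0 -sumrB.
  by apply: eq_bigr => i _; rewrite mulrBr.
pose K := \sum_(i <- s) `|a i|.
have T0 N : K * 2 < N.+1%:R -> T N.+1 = 0.
  move=> KN; have fN m : 0 < (m`!%:R : R) by rewrite ltr0n fact_gt0.
  (* By [TE] the tail is minus an integer combination of partial sums whose denominators divide
     [N!]. *)
  have TZ : N`!%:R * T N.+1 \is a Num.int.
    rewrite TE mulrN rpredN mulr_sumr big_seq rpred_sum// => i si.
    by rewrite mulrCA rpredM ?aZ ?fact_psum_invfact_int.
  apply: contraTeq KN => TN0; rewrite -leNgt.
  have : 1 <= `|N`!%:R * T N.+1|.
    by apply: norm_intr_ge1 => //; rewrite mulf_neq0// gt_eqF.
  rewrite normrM gtr0_norm// => le1.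
  (* Multiplied by [N!] the bound becomes [2 K / (N + 1)], so a nonzero tail forces
     [N + 1 <= 2 K]. *)
  have : `|T N.+1| <= K * (2 / (N.+1)`!%:R).
    rewrite /K mulr_suml (le_trans (ler_norm_sum _ _ _))//.
    apply: ler_sum => i _; rewrite normrM ler_wpM2l//.
    by have /andP[? ?] := sum_invfact_bounds (S i) (ltn0Sn N); rewrite ger0_norm.
  rewrite -(ler_pM2l (fN N)) => /(le_trans le1).
  rewrite [leRHS]mulrC factS natrM invfM.
  rewrite -!mulrA mulVf ?gt_eqF// mulr1 mulrA ler_pdivlMr ?ltr0n//.
  by rewrite mul1r.
exists (Num.bound (K * 2)).+1 => -[//|N]; rewrite ltnS => NK.
have KN m : (N <= m)%N -> K * 2 < m.+1%:R.
  move=> Nm; apply: lt_le_trans (archi_boundP _) _.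
    by rewrite mulr_ge0// sumr_ge0.
  by rewrite ler_nat (leq_trans NK)// (leq_trans Nm).
(* The tails at [N.+1] and [N.+2] both vanish; only the terms of index [N.+1] distinguish them. *)
have := T0 _ (KN _ (leqnSn N)); rewrite -[RHS](T0 _ (KN _ (leqnn N))).
rewrite !TE => /oppr_inj/eqP; rewrite -subr_eq0 -sumrB.
under eq_bigr => i _ do rewrite -mulrBr psum_invfactS addrC addKr.
rewrite (eq_bigr (fun i => (if S i N.+1 then a i else 0) / (N.+1)`!%:R)).
  by rewrite -mulr_suml -big_mkcond mulf_eq0 invr_eq0 pnatr_eq0 eqn0Ngt fact_gt0 orbF => /eqP.
by move=> i _; case: ifP; rewrite ?mulr0 ?mul0r.
Qed.

(* For x != y, the codes of x and of y have finitely many elements in common. *)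
Definition floor_code (x : R) n : nat := pickle (n, Num.floor (n%:R * x)).

Definition floor_codes (x : R) : pred nat :=
  fun N => if unpickle N is Some (n, m) then m == Num.floor (n%:R * x)
           else false.

Lemma floor_codesE (x y : R) n :
  floor_codes y (floor_code x n) = (Num.floor (n%:R * x) == Num.floor (n%:R * y)).
Proof. by rewrite /floor_codes pickleK. Qed.

(** Once [n * |x - y| > 1], the two products are too far apart to share a floor. *)
Lemma floor_mul_neq (x y : R) : x != y ->
  exists K, forall n, (K <= n)%N -> Num.floor (n%:R * x) != Num.floor (n%:R * y).
Proof.
move=> xy; exists (Num.bound (`|x - y|^-1)) => n Kn.
apply/eqP => fxy.
have n1 : 1 < n%:R * `|x - y|.
  rewrite -ltr_pdivrMr ?normr_gt0 ?subr_eq0// div1r.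
  apply: lt_le_trans (archi_boundP _) _; first by rewrite invr_ge0.
  by rewrite ler_nat.
have : `|n%:R * x - n%:R * y| < 1.
  have /andP[x1 x2] := floor_itv (n%:R * x).
  have /andP[y1 y2] := floor_itv (n%:R * y).
  rewrite -fxy in y1 y2; rewrite !intrD in x2 y2.
  rewrite ltr_norml ltrNl opprB !ltrBlDl; apply/andP; split.
    by rewrite (lt_le_trans y2)// lerD2r.
  by rewrite (lt_le_trans x2)// lerD2r.
by rewrite -mulrBr normrM ger0_norm// ltNge ltW.
Qed.

(** Pigeonhole: otherwise [f] would inject the [N0 + 1] indices from [K] on into [N0] values. *)
Lemma inj_unbounded (f : nat -> nat) (K N0 : nat) : injective f ->
  exists2 n, (K <= n)%N & (N0 <= f n)%N.
Proof.
move=> inj_f; apply: contrapT => H.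
have lt (i : 'I_N0.+1) : (f (K + i) < N0)%N.
  by rewrite ltnNge; apply/negP => ?; apply: H; exists (K + i)%N; rewrite ?leq_addr.
have := @leq_card _ _ (fun i : 'I_N0.+1 => Ordinal (lt i)).
rewrite !card_ord ltnn => Ninj; suff: false by [].
by apply: Ninj => i j [] /inj_f/addnI/val_inj.
Qed.

(** After clearing denominators, the relation is read at a large code of [x] that belongs to
    [floor_codes y] for no other [y] in [s]; only the coefficient of [x] survives there. *)
Lemma Qfree_family_reals : exists t : R -> R^o, Qfree_family [set: R] t.
Proof.
exists (fun x => sum_invfact (floor_codes x)) => s c us _ s0 x xs.
pose D : rat := \prod_(y <- s) (denq (c y))%:~R.
have D0 : D != 0 by rewrite prodf_seq_neq0; apply/allP => y _; rewrite intr_eq0 denq_eq0.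
have DcZ y : y \in s -> ratr (D * c y) \is a @Num.int R.
  move=> ys; rewrite /D (big_rem y)//= mulrAC [_ * c y]mulrC -numqE -rmorph_prod -intrM.
  by rewrite ratr_int intr_int.
have [|N0 HN0] := sum_invfact_relation (S := floor_codes) DcZ.
  under eq_bigr => y _ do rewrite rmorphM -mulrA.
  by rewrite -mulr_sumr [X in _ * X]s0 mulr0.
have [K HK] : exists K, forall y, y \in s -> y != x -> forall n, (K <= n)%N ->
    Num.floor (n%:R * x) != Num.floor (n%:R * y).
  elim: (s) => [|y r [K HK]]; first by exists 0%N.
  have [yx|xy] := eqVneq x y.
    exists K => z; rewrite inE => /predU1P[->|]; first by rewrite yx eqxx.
    exact: HK.
  have [K' HK'] := floor_mul_neq xy.
  exists (maxn K K') => z; rewrite inE => zr zx n; rewrite geq_max => /andP[Kn K'n].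
  by case/predU1P: zr => [->|zr]; [exact: HK'|exact: HK].
have [|n Kn Nn] := @inj_unbounded (floor_code x) K N0.
  by move=> m n /(pcan_inj pickleK)[].
have := HN0 _ Nn; under eq_bigl => y do rewrite floor_codesE.
rewrite (big_rem x)//= eqxx big1_seq ?addr0 => [|y /andP[fxy ys]].
  by move/eqP; rewrite fmorph_eq0 mulf_eq0 (negPf D0) => /eqP.
move: ys; rewrite mem_rem_uniq// inE => /andP[yx ys].
by rewrite (negPf (HK _ ys yx _ Kn)) in fxy.
Qed.

End FactorialSums.

(** * A basis equipotent with its complement *)

Lemma set_inj_card_le (T U : Type) (A : set T) (B : set U) (f : T -> U) :
  set_inj A f -> (forall x, A x -> B (f x)) -> (A #<= B)%card.
Proof.
move=> inj_f AB; rewrite -(card_le_eql (inj_card_eq inj_f)).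
by apply: subset_card_le => _ [x /AB + <-].
Qed.

Lemma Qfree_notin0 (R : realType) (V : lmodType R) (B : set V) :
  Qfree B -> ~ B 0.
Proof.
move=> frB B0.
have sB : {in [:: 0], forall v, B v} by move=> v; rewrite inE => /eqP ->.
have := frB [:: 0] (fun=> 1) isT sB.
rewrite /Qcomb big_seq1 scaler0 => /(_ erefl 0 (mem_head _ _))/eqP.
by rewrite oner_eq0.
Qed.

(** Negation embeds [B] in its complement, since [b + (- b) = 0] is a relation. The independent
    family [t], with values in [B], embeds all of [R] in [B]. Cantor-Bernstein concludes. *)
Lemma Qbasis_compl_bij (R : realType) :
  exists (B : set R^o) (psi : R^o -> R^o), Qbasis B /\ set_bij (~` B) B psi.
Proof.
have [t frt] := @Qfree_family_reals R.
have inj_t : injective t.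
  move=> x y txy; apply: contrapT => /eqP xy.
  have := frt [:: x; y] (fun z => if z == x then 1 else -1).
  rewrite /= inE xy !big_cons big_nil eqxx eq_sym (negPf xy).
  rewrite rmorph1 rmorphN1 scale1r scaleN1r addr0 txy subrr.
  by move=> /(_ isT (fun _ _ => I) erefl x (mem_head _ _))/eqP; rewrite eqxx oner_eq0.
have frT : Qfree (range t).
  move=> s c us sT s0.
  have preim v : exists x, v \in s -> t x = v.
    have [vs|_] := boolP (v \in s); last by exists 0.
    by have [x _ <-] := sT v vs; exists x.
  have [g gP] := choice preim.
  move=> v vs; rewrite -(gP v vs).
  apply: (frt (map g s) (c \o t)); last by rewrite map_f.
  - by rewrite map_inj_in_uniq// => x y /gP {2}<- /gP {2}<- ->.
  - by [].
  - by rewrite big_map -[RHS]s0; apply: eq_big_seq => w ws; rewrite /= gP.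
have [B [TB basB]] := Qbasis_extension frT.
have [frB _] := basB.
have nB b : B b -> ~ B (- b).
  move=> Bb BNb.
  have b0 : b != 0 by apply/eqP => b0; rewrite b0 in Bb; exact: Qfree_notin0 frB Bb.
  have bNb : b != - b by rewrite -subr_eq0 opprK -mulr2n mulrn_eq0.
  have := frB [:: b; - b] (fun=> 1).
  rewrite /Qcomb /= inE bNb !big_cons big_nil rmorph1 !scale1r addr0 subrr.
  have sB : {in [:: b; - b], forall v, B v}.
    by move=> v; rewrite !inE => /orP[] /eqP ->.
  by move=> /(_ isT sB erefl b (mem_head _ _))/eqP; rewrite oner_eq0.
have BN : (B #<= ~` B)%card.
  by apply: (set_inj_card_le (f := -%R)) => // x y _ _ /oppr_inj.
have NB : (~` B #<= B)%card.
  by apply: (set_inj_card_le (f := t)) => [x y _ _ /inj_t //|x _]; apply: TB; exists x.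
pose Rpt : pointedType := HB.pack (Real.sort R) (Choice.on R) (isPointed.Build R 0).
have /(@card_set_bijP _ Rpt)[psi psiP] := Cantor_Bernstein NB BN.
by exists B, psi.
Qed.

(** * The two Hamel functions whose composition is a given constant *)

Theorem corollary1 (R : realType) (g : R -> R)
    (g_const : exists c : R, forall x : R, g x = c) :
  exists f h : R -> R, [/\ Hamel f, Hamel h & g = h \o f].
Proof.
have [c gE] := g_const.
have [B [psi [basB [psiB inj_psi surj_psi]]]] := Qbasis_compl_bij R.
have [frB spB] := basB.
have NB0 : ~ B 0 := Qfree_notin0 frB.
have frpsi : Qfree_family (~` B) psi by apply: Qfree_inj frB _ _.
(* With [eps] the sum of the coordinates over [B], [L] is [eps * psi 0] and [M] is [eps * c]; the
   function [k] chosen below is [eps]. *)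
have [L [linL LB]] := Qlinear_extension (fun=> psi 0 : R^o) basB.
have [M [linM MB]] := Qlinear_extension (fun=> c : R^o) basB.
have Lline x : exists q, L x = ratr q *: psi 0.
  have : Qspan B x by rewrite spB.
  apply: (Qspan_min (S := [set x | exists q, L x = ratr q *: psi 0])).
    split=> /= [|q y z [a Ly] [b Lz]].
      by exists 0; rewrite (Qlinear0 linL) rmorph0 scale0r.
    by exists (q * a + b); rewrite linL Ly Lz scalerA -rmorphM -scalerDl -rmorphD.
  by move=> b Bb; exists 1; rewrite LB// rmorph1 scale1r.
have [k kP] := choice Lline.
(* This makes [k] uniquely determined, whence [k 0 = 0], as the shift at index 0 requires. *)
have psi0_neq0 : psi 0 != 0.
  by apply/eqP => psi00; have := psiB 0 NB0; rewrite psi00.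
have k0 : k 0 = 0.
  apply/eqP; have := kP 0; rewrite (Qlinear0 linL) => /esym/eqP.
  by rewrite scaler_eq0 (negPf psi0_neq0) orbF fmorph_eq0.
pose f (x : R^o) : R^o := if x \in B then psi 0 else psi x.
pose h (x : R^o) : R^o := if x \in B then c else M x + psi x.
exists f, h; split.
- apply: (@Hamel_perturb _ B L (fun x => psi x - L x)) => //.
  + by move=> b Bb; rewrite /f mem_set// LB.
  + by move=> x NBx; rewrite /f memNset// addrC subrK.
  + rewrite (_ : (fun x => _) = fun x => psi x - ratr (k x) *: psi 0).
      exact: Qfree_family_shift.
    by apply/funext => x; rewrite kP.
  + apply/seteqP; split => // y _; have : Qspan B y by rewrite spB.
    have subS := Qsubspace_Qspan [set psi x - L x | x in ~` B].
    apply: (Qspan_min subS) => _ /surj_psi[x NBx <-].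
    (* [L] vanishes at 0, so [psi 0] is itself one of the values; adding multiples of it recovers
       every [psi x], hence all of [B]. *)
    have S0 : Qspan [set psi x - L x | x in ~` B] (psi 0).
      by apply: sub_Qspan; exists 0 => //; rewrite (Qlinear0 linL) subr0.
    rewrite (_ : psi x = ratr (k x) *: psi 0 + (psi x - L x)).
      by apply: subS.2 => //; apply: sub_Qspan; exists x.
    by rewrite kP addrC subrK.
- apply: (@Hamel_perturb _ B M psi) => //.
  + by move=> b Bb; rewrite /h mem_set// MB.
  + by move=> x NBx; rewrite /h memNset.
  + by rewrite (_ : psi @` _ = B)//; apply/seteqP; split => // _ [x /psiB + <-].
- apply/funext => x /=; rewrite gE /h mem_set// /f.
  by case: ifPn => [_|/negP NBx]; apply: psiB => // /mem_set.
Qed.
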